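(* Let $p\in\left[\frac{3}{2},3\right]$, and let $\ell_p^2$ denote the real space $\mathbb{R}^2$ endowed with the norm $\|(a,b)\|_p=(|a|^p+|b|^p)^{1/p}$. Then $$ n(\ell_p^2)=M_p=\sup_{t\in[0,1]} \dfrac{|t^{p-1}-t|}{1+t^p}. $$
   Context: For a real Banach space $X$, $X^*$ is its topological dual with the dual norm and $\mathcal{L}(X)$ is the space of bounded linear operators on $X$ with the operator norm. For $T\in\mathcal{L}(X)$, the numerical radius is $$v(T)=\sup\{|x^*(Tx)| : x^*\in X^*,\ x\in X,\ \|x^*\|=\|x\|=x^*(x)=1\},$$ and the numerical index of $X$ is $n(X)=\inf\{v(T): T\in\mathcal{L}(X),\ \|T\|=1\}$. For $1<p<\infty$, $M_p:=\max_{t\in[0,1]}\frac{|t^{p-1}-t|}{1+t^p}$. *)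

(* Defs.v *)
From HB Require Import structures.
From mathcomp Require Import all_boot all_order all_algebra.
From mathcomp Require Import all_classical all_reals all_analysis.
From mathcomp Require Import ring lra.

Set Implicit Arguments.
Unset Strict Implicit.
Unset Printing Implicit Defensive.

Import Order.TTheory GRing.Theory Num.Theory.
Import numFieldNormedType.Exports.

Local Open Scope classical_set_scope.
Local Open Scope ring_scope.

Definition operator_norm (R : realType) (X Y : normedModType R) (f : X -> Y) : R :=
  sup [set `|f x| | x in [set x : X | `|x| <= 1]].

Definition numerical_radius (R : realType) (X : normedModType R) (T : X -> X) : R :=
  sup [set r : R | exists (f : {linear X -> R^o}) (x : X),
    [/\ continuous f, operator_norm f = 1, `|x| = 1, f x = 1 & r = `|f (T x)|]].

(* For linear T, boundedness near 0 is boundedness as an operator: see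
   linear_boundedP. *)
Definition numerical_index (R : realType) (X : normedModType R) : R :=
  inf [set r : R | exists T : {linear X -> X},
    [/\ bounded_near T (nbhs 0), operator_norm T = 1 & r = numerical_radius T]].

Definition lp2 (R : realType) (p : R) (p1 : 1 <= p) : Type := (R^o * R^o)%type.

Section lp2_normed.
Context (R : realType) (p : R) (p1 : 1 <= p).

HB.instance Definition _ := GRing.Lmodule.copy (lp2 p1) (R^o * R^o)%type.

Definition lp2_norm (x : lp2 p1) : R :=
  (`|x.1| `^ p + `|x.2| `^ p) `^ p^-1.

Let p_gt0 : 0 < p. Proof. exact: lt_le_trans ltr01 p1. Qed.
Let p_neq0 : p != 0. Proof. by rewrite gt_eqF. Qed.

Let S (x : lp2 p1) := `|x.1| `^ p + `|x.2| `^ p.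

Let S_ge0 x : 0 <= S x. Proof. by rewrite addr_ge0 ?powR_ge0. Qed.

Let lp2_norm_ge0 x : 0 <= lp2_norm x. Proof. exact: powR_ge0. Qed.

Let lp2_normX x : lp2_norm x `^ p = S x.
Proof. by rewrite -powRrM mulVf// powRr1. Qed.

Let lp2_norm0_eq0 x : lp2_norm x = 0 -> x = 0.
Proof.
move=> /powR_eq0_eq0 /eqP; rewrite paddr_eq0 ?powR_ge0//.
case: x => a b /= /andP[/eqP/powR_eq0_eq0/normr0_eq0 -> /eqP/powR_eq0_eq0/normr0_eq0 ->].
by [].
Qed.

Let lp2_normZ (l : R) x : lp2_norm (l *: x) = `|l| * lp2_norm x.
Proof.
rewrite /lp2_norm /= !normrZ !powRM// -mulrDr powRM ?powR_ge0//.
by rewrite -powRrM mulfV// powRr1.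
Qed.

Let powR_cvx (u v A B : R) : 0 <= u -> 0 <= v -> 0 < A -> 0 < B ->
  (u + v) `^ p <= (A + B) `^ p * (A / (A + B) * (u `^ p / A `^ p)
                                + B / (A + B) * (v `^ p / B `^ p)).
Proof.
move=> u0 v0 A0 B0; have AB0 : 0 < A + B by rewrite addr_gt0.
have t0 : 0 <= A / (A + B) by rewrite divr_ge0// ltW.
have t1 : A / (A + B) <= 1 by rewrite ler_pdivrMr// mul1r lerDl ltW.
have uA : 0 <= u / A by rewrite divr_ge0// ltW.
have vB : 0 <= v / B by rewrite divr_ge0// ltW.
have : (A / (A + B) * (u / A) + (1 - A / (A + B)) * (v / B)) `^ p <=
    A / (A + B) * (u / A) `^ p + (1 - A / (A + B)) * (v / B) `^ p.
  by apply: (@convex_powR R p p1 (Itv01 t0 t1) (u / A) (v / B));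
    rewrite inE /= in_itv /= andbT.
have -> : 1 - A / (A + B) = B / (A + B) by field; rewrite gt_eqF.
have -> : A / (A + B) * (u / A) + B / (A + B) * (v / B) = (u + v) / (A + B).
  by field; rewrite !gt_eqF.
rewrite !powRM ?invr_ge0 ?addr_ge0 ?(ltW A0) ?(ltW B0)//.
have powRV (a : R) : 0 < a -> a^-1 `^ p = (a `^ p)^-1.
  by move=> a0; rewrite -(powR_inv1 (ltW a0)) -powRrM mulN1r powRN.
by rewrite !powRV// ler_pdivrMr ?powR_gt0// mulrC.
Qed.

Let minkowski2 (u1 u2 v1 v2 A B : R) :
  0 <= u1 -> 0 <= u2 -> 0 <= v1 -> 0 <= v2 -> 0 < A -> 0 < B ->
  u1 `^ p + u2 `^ p = A `^ p -> v1 `^ p + v2 `^ p = B `^ p ->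
  (u1 + v1) `^ p + (u2 + v2) `^ p <= (A + B) `^ p.
Proof.
move=> u10 u20 v10 v20 A0 B0 uA vB.
have AB0 : 0 < A + B by exact: addr_gt0.
apply: (le_trans (lerD (powR_cvx u10 v10 A0 B0) (powR_cvx u20 v20 A0 B0))).
rewrite -mulrDr addrACA -!mulrDr -!mulrDl uA vB.
by rewrite !divff ?gt_eqF ?powR_gt0// !mulr1 -mulrDl divff ?gt_eqF// mulr1.
Qed.

Let lp2_normD x y : lp2_norm (x + y) <= lp2_norm x + lp2_norm y.
Proof.
have [/eqP/lp2_norm0_eq0 ->|x0] := boolP (lp2_norm x == 0).
  by rewrite add0r lerDr.
have [/eqP/lp2_norm0_eq0 ->|y0] := boolP (lp2_norm y == 0).
  by rewrite addr0 lerDl.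
have A0 : 0 < lp2_norm x by rewrite lt_neqAle eq_sym x0 lp2_norm_ge0.
have B0 : 0 < lp2_norm y by rewrite lt_neqAle eq_sym y0 lp2_norm_ge0.
have le_powD (a b : R) : `|a + b| `^ p <= (`|a| + `|b|) `^ p.
  by apply: ge0_ler_powR; rewrite ?nnegrE ?addr_ge0 ?(ltW p_gt0)// ler_normD.
have := minkowski2 (normr_ge0 x.1) (normr_ge0 x.2) (normr_ge0 y.1)
  (normr_ge0 y.2) A0 B0 (esym (lp2_normX x)) (esym (lp2_normX y)).
move: (lp2_norm x) (lp2_norm y) A0 B0 => A B A0 B0 {x0 y0} le_AB.
have AB0 : 0 < A + B by exact: addr_gt0.
have {le_AB} le_AB : S (x + y) <= (A + B) `^ p.
  exact: le_trans (lerD (le_powD _ _) (le_powD _ _)) le_AB.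
have : S (x + y) `^ p^-1 <= ((A + B) `^ p) `^ p^-1.
  apply: ge0_ler_powR => //; first by rewrite invr_ge0 ltW.
    by rewrite nnegrE S_ge0.
  by rewrite nnegrE powR_ge0.
by rewrite -powRrM mulfV// powRr1// ltW.
Qed.

HB.instance Definition _ :=
  Lmodule_isNormed.Build R (lp2 p1) lp2_normD lp2_normZ lp2_norm0_eq0.

Lemma lp2_normE (x : lp2 p1) :
  `|x| = (`|x.1 : R| `^ p + `|x.2 : R| `^ p) `^ p^-1.
Proof. by []. Qed.

End lp2_normed.

Lemma ge1_itv (R : realType) (p : R) : p \in `[3 / 2, 3] -> 1 <= p.
Proof. by rewrite in_itv /= => /andP[? _]; lra. Qed.

Definition Mp_quotient (R : realType) (p t : R) : R :=
  `|t `^ (p - 1) - t| / (1 + t `^ p).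

(* The default 0 of xget is never used: see Mp_max. *)
Definition Mp (R : realType) (p : R) : R :=
  let S := [set Mp_quotient p t | t in `[0, 1]] in
  xget 0 [set m | S m /\ ubound S m].

Lemma Mp_max (R : realType) (p : R) : 1 < p ->
  let S := [set Mp_quotient p t | t in `[0, 1]] in S (Mp p) /\ ubound S (Mp p).
Proof.
move=> p1 S.
have cpow (q : R) : 0 < q -> {within `[0, 1], continuous (fun t : R => t `^ q)}.
  move=> q0.
  have cpos (x : R) : 0 < x -> {for x, continuous (fun t : R => t `^ q)}.
    move=> x0; apply/differentiable_continuous/derivable1_diffP.
    by apply: derivable_powR; rewrite in_itv /= x0.
  apply/continuous_within_itvP => //; split.
  - by move=> x; rewrite in_itv /= => /andP[x0 _]; exact: cpos.
  - by rewrite powR0 ?gt_eqF//; exact: powR_cvg0.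
  - exact: cvg_at_left_filter (cpos 1 ltr01).
have cq : {within `[0, 1], continuous (Mp_quotient p)}.
  have ct : {within `[0, 1], continuous (@id R)} by apply: continuous_subspaceT => ?; exact: cvg_id.
  move=> x; apply: cvgM.
    by apply: cvg_norm; apply: cvgB; [apply: cpow; lra | exact: ct].
  apply: cvgV; first by rewrite gt_eqF// ltr_wpDr ?powR_ge0.
  by apply: cvgD; [exact: cvg_cst | apply: cpow; lra].
have [c c01 cmax] := EVT_max ler01 cq.
have /(xgetPex 0) : exists m, S m /\ ubound S m.
  exists (Mp_quotient p c); split; first by exists c.
  by move=> _ [t t01 <-]; exact: cmax.
by [].
Qed.

(* Main.v *)
From HB Require Import structures.
Require Import Defs.
From mathcomp Require Import all_boot all_order all_algebra.
From mathcomp Require Import all_classical all_reals all_analysis.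
From mathcomp Require Import ring lra.

Import Order.TTheory GRing.Theory Num.Theory.
Import numFieldNormedType.Exports.

Local Open Scope classical_set_scope.
Local Open Scope ring_scope.

(* Write an operator on the plane with matrix [[a, b], [c, d]] as a combination
   of the four isometries (x, y), (x, -y), (y, x) and (y, -x) of l_p^2: its norm
   is at most (|a + d| + |a - d| + |b + c| + |b - c|) / 2. Testing the operator
   on the vectors (1, ±t) and (t, ±1) only, for a single t maximising the
   quotient that defines M_p, and writing u = t^(p-1), its numerical radius V
   satisfies
     |a + d t u| + |b t + c u| <= V (1 + t u),
     |a t u + d| + |b u + c t| <= V (1 + t u).
   Together these give M_p (|a + d| + |a - d| + |b + c| + |b - c|) / 2 <= V by
   linear programming, as soon as t^2 <= u and u^2 <= t, that is, for p in
   [3/2, 3]. Conversely, the rotation (y, -x) has norm 1, and its numerical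
   radius is M_p because the support functional at a unit vector is unique. *)

(** * Linear programming for the lower bound *)

(** The hypotheses contain three linear bounds by [V]. Weighted by [(k + l) / 2], [(1 - l) / 2] and
    [(1 - k) / 2], which sum to 1, they give [k x + l y + (1 - k - l) z + w <= V], and
    [g <= 1 - k - l]. *)
Lemma weighted_le_of_nonneg (R : realFieldType) (k l g x y z w V : R) :
  0 <= k -> 0 <= l -> 0 <= g -> k + l + g <= 1 ->
  0 <= x -> 0 <= y -> 0 <= z -> 0 <= w ->
  x + y + (w - z) <= V -> `|x - y| + (z + w) <= V ->
  k * x + l * y + g * z + w <= V.
Proof.
move=> k0 l0 g0 klg x0 y0 z0 w0 h1 h2.
have [h3 h4] : x - y + (z + w) <= V /\ y - x + (z + w) <= V.
  by have := ler_norm (x - y); have := ler_norm (y - x); rewrite distrC; lra.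
have := mulr_ge0 g0 z0.
have : 0 <= (1 - k - l - g) * z by apply: mulr_ge0; lra.
have : 0 <= (k + l) / 2 * (V - (x + y + (w - z))) by apply: mulr_ge0; lra.
have : 0 <= (1 - l) / 2 * (V - (x - y + (z + w))) by apply: mulr_ge0; lra.
have : 0 <= (1 - k) / 2 * (V - (y - x + (z + w))) by apply: mulr_ge0; lra.
lra.
Qed.

(** Sign changes of [(x, y)], of [(z, w)] and of [(y, w)], the last one exchanging the two bounds by
    [V], reduce to [x, y, z >= 0]. For [w < 0] the first bound controls [x + y + z + |w|], and the
    weights are at most 1. *)
Lemma weighted_norm_le (R : realFieldType) (k l g x y z w V : R) :
  0 <= k -> 0 <= l -> 0 <= g -> k + l + g <= 1 ->
  `|x + y| + `|z - w| <= V -> `|x - y| + `|z + w| <= V ->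
  k * `|x| + l * `|y| + g * `|z| + `|w| <= V.
Proof.
move=> k0 l0 g0 klg.
wlog x0 : x y z w / 0 <= x.
  move=> H; have [x0|/ltW x0] := leP 0 x; first exact: H.
  move=> h1 h2.
  rewrite -(normrN x) -(normrN y); apply: H => //; first by rewrite oppr_ge0.
    by rewrite -opprD normrN.
  by rewrite -opprD normrN.
wlog z0 : x y z w x0 / 0 <= z.
  move=> H; have [z0|/ltW z0] := leP 0 z; first exact: H.
  move=> h1 h2.
  rewrite -(normrN z) -(normrN w); apply: H => //; first by rewrite oppr_ge0.
    by rewrite -opprD normrN.
  by rewrite -opprD normrN.
wlog y0 : y w / 0 <= y.
  move=> H; have [y0|/ltW y0] := leP 0 y; first exact: H.
  move=> h1 h2.
  rewrite -(normrN y) -(normrN w); apply: H; rewrite ?oppr_ge0 ?opprK//.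
have [w0|w0] := leP 0 w => h1 h2.
  rewrite !ger0_norm//; apply: weighted_le_of_nonneg => //.
    by have := ler_norm (x + y); have := ler_norm (w - z); rewrite distrC; lra.
  by have := ler_norm (z + w); lra.
rewrite (ger0_norm x0) (ger0_norm y0) (ger0_norm z0) (ltr0_norm w0).
have := ler_norm (x + y); have := ler_norm (z - w).
have : 0 <= (1 - k) * x by apply: mulr_ge0; lra.
have : 0 <= (1 - l) * y by apply: mulr_ge0; lra.
have : 0 <= (1 - g) * z by apply: mulr_ge0; lra.
lra.
Qed.

(* If [u <= t], the sum is at most [1] exactly when
   [t^2 - u^2 <= u (1 - t^2 u^2)], which [t^2 <= u] implies. *)
Lemma weights_le1 (R : realFieldType) (t u : R) :
  0 < t -> 0 < u -> t < 1 -> u < 1 -> t ^+ 2 <= u -> u ^+ 2 <= t ->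
  `|t - u| / (1 + t * u) + `|t - u| / (1 - t * u) + `|t - u| / (t + u) <= 1.
Proof.
wlog ut : t u / u <= t.
  move=> H; have [ut|/ltW tu] := leP u t; first exact: H.
  move=> t0 u0 t1 u1 h1 h2.
  by rewrite distrC (mulrC t) (addrC t); exact: H.
move=> t0 u0 t1 u1 tu _; rewrite ger0_norm ?subr_ge0//.
have tu1 : t * u < 1 by nra.
have tu0 : 0 < t * u by rewrite mulr_gt0.
have key : t ^+ 2 - u ^+ 2 <= u * (1 - t ^+ 2 * u ^+ 2).
  have : t ^+ 2 * u <= 1 by nra.
  nra.
rewrite -subr_ge0.
have -> : 1 - ((t - u) / (1 + t * u) + (t - u) / (1 - t * u) + (t - u) / (t + u)) =
  2 * (u * (1 - t ^+ 2 * u ^+ 2) - (t ^+ 2 - u ^+ 2)) /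
  ((1 + t * u) * (1 - t * u) * (t + u)).
  by field; rewrite !gt_eqF//; lra.
by rewrite divr_ge0// ?mulr_ge0//; lra.
Qed.

Lemma isometry_coef_bound (R : realFieldType) (t u a b c d V : R) :
  0 < t -> 0 < u -> t < 1 -> u < 1 -> t ^+ 2 <= u -> u ^+ 2 <= t ->
  `|a + d * (t * u)| + `|b * t + c * u| <= V * (1 + t * u) ->
  `|a * (t * u) + d| + `|b * u + c * t| <= V * (1 + t * u) ->
  (`|a + d| + `|a - d| + `|b + c| + `|b - c|) / 2 * (`|t - u| / (1 + t * u)) <= V.
Proof.
move=> t0 u0 t1 u1 tu ut h1 h2.
have tu1 : t * u < 1 by nra.
have tu0 : 0 < t * u by rewrite mulr_gt0.
have := weights_le1 R t u t0 u0 t1 u1 tu ut.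
set k := _ / (1 + t * u); set l := _ / (1 - t * u); set g := _ / (t + u) => klg.
have [k0 l0 g0] : [/\ 0 <= k, 0 <= l & 0 <= g].
  by split; apply: divr_ge0; rewrite ?normr_ge0//; lra.
have divV (z : R) : `|z| / (1 + t * u) = `|z / (1 + t * u)|.
  by rewrite normrM normfV (gtr0_norm (x := 1 + t * u))//; lra.
(* The tested expressions, divided by [1 + t u], become [x + y], [x - y], [z + w], [z - w]. The
   scalings make [k |x|], [l |y|], [g |z|], [|w|] equal to [|a + d|], [|a - d|], [|b + c|],
   [|b - c|] times the common factor [|t - u| / (2 (1 + t u))]. *)
pose x := (a + d) / 2; pose y := (a - d) / 2 * (1 - t * u) / (1 + t * u).
pose z := (b + c) / 2 * (t + u) / (1 + t * u).
pose w := (b - c) / 2 * (t - u) / (1 + t * u).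
have X1 : x + y = (a + d * (t * u)) / (1 + t * u) by rewrite /x /y; field; lra.
have X2 : x - y = (a * (t * u) + d) / (1 + t * u) by rewrite /x /y; field; lra.
have Z1 : z + w = (b * t + c * u) / (1 + t * u) by rewrite /z /w; field; lra.
have Z2 : z - w = (b * u + c * t) / (1 + t * u) by rewrite /z /w; field; lra.
have P0 : 0 < 1 + t * u by lra.
have H1 : `|x + y| + `|z - - w| <= V.
  by rewrite opprK X1 Z1 -!divV -mulrDl ler_pdivrMr.
have H2 : `|x - y| + `|z + - w| <= V.
  by rewrite X2 Z2 -!divV -mulrDl ler_pdivrMr.
have := weighted_norm_le R k l g x y z (- w) V k0 l0 g0 klg H1 H2.
rewrite normrN /x /y /z /w -!divV !normrM !(ger0_norm (x := 2^-1)) ?invr_ge0//.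
rewrite (gtr0_norm (x := 1 - _)) ?(gtr0_norm (x := t + u)); try lra.
congr (_ <= _); rewrite /k /l /g; field; rewrite !gt_eqF//; lra.
Qed.

(** * Power inequalities and uniqueness of support functionals *)

Lemma powR_pred_mul (R : realType) (p y : R) : 0 < p -> 0 <= y ->
  y `^ (p - 1) * y = y `^ p.
Proof.
move=> p0 y0; rewrite -[X in _ * X](powRr1 y0) -powRD ?subrK//.
by rewrite gt_eqF.
Qed.

Lemma powR_conjugate (R : realType) (p y : R) : 1 < p -> 0 <= y ->
  (y `^ (p - 1)) `^ (p / (p - 1)) = y `^ p.
Proof.
by move=> p1 y0; rewrite -powRrM; congr (_ `^ _); field; lra.
Qed.

Lemma conjugate_exponent (R : realType) (p : R) : 1 < p ->
  p^-1 + (p / (p - 1))^-1 = 1.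
Proof. by move=> p1; field; lra. Qed.

(** Hoelder's inequality for the exponents [p / (p - 1)] and [p]; it bounds the norm of the
    functional with coefficients [A^(p-1)] and [B^(p-1)]. *)
Lemma powR_hoelder (R : realType) (p A B x y : R) :
  1 < p -> 0 <= A -> 0 <= B -> 0 <= x -> 0 <= y ->
  A `^ (p - 1) * x + B `^ (p - 1) * y <=
    (A `^ p + B `^ p) `^ (1 - p^-1) * (x `^ p + y `^ p) `^ p^-1.
Proof.
move=> p1 A0 B0 x0 y0; have p0 : 0 < p by lra.
have q0 : 0 < p / (p - 1) by rewrite divr_gt0//; lra.
have := hoelder2 (powR_ge0 A (p - 1)) (powR_ge0 B (p - 1)) x0 y0 q0 p0.
rewrite (powR_conjugate R p A p1 A0) (powR_conjugate R p B p1 B0).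
have <- : (p / (p - 1))^-1 = 1 - p^-1 by field; lra.
by apply; rewrite addrC conjugate_exponent.
Qed.

(** Convexity of the power function, read off from Young's inequality for [x] and [y^(p-1)]. *)
Lemma powR_tangent_le (R : realType) (p x y : R) : 1 < p -> 0 <= x -> 0 <= y ->
  y `^ p + p * y `^ (p - 1) * (x - y) <= x `^ p.
Proof.
move=> p1 x0 y0; have p0 : 0 < p by lra.
have q0 : 0 < p / (p - 1) by rewrite divr_gt0//; lra.
have := conjugate_powR x0 (powR_ge0 y (p - 1)) p0 q0 (conjugate_exponent R p p1).
rewrite powR_conjugate// -(ler_pM2l p0).
have -> : p * (x `^ p / p + y `^ p / (p / (p - 1))) = x `^ p + (p - 1) * y `^ p.
  by field; lra.
have := powR_pred_mul R p y p0 y0.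
nra.
Qed.

(** The right-hand side of the hypothesis has slope [A^(p-1)] at [a = A]. Tangent inequalities at
    one well-chosen [a] replace differentiation. *)
Lemma supporting_slope_le (R : realType) (p A F : R) : 1 < p -> 0 <= A ->
  (forall a, A <= a -> 1 + F * (a - A) <= (a `^ p - A `^ p + 1) `^ p^-1) ->
  F <= A `^ (p - 1).
Proof.
move=> p1 A0 H; rewrite leNgt; apply/negP => AF.
have p0 : 0 < p by lra.
have A1 := powR_ge0 A (p - 1).
(* [r] lies strictly between [A^(p-1)] and [F], and [a^(p-1) = r], so [A < a]. The tangent at 1
   gives [1 + p F (a - A) <= (1 + F (a - A))^p], the tangent at [a] gives
   [a^p - A^p <= p r (a - A)]; together they contradict [r < F]. *)
pose r := (F + A `^ (p - 1)) / 2; pose a := r `^ (p - 1)^-1.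
have r0 : 0 <= r by rewrite /r; lra.
have a0 : 0 <= a by rewrite powR_ge0.
have ar : a `^ (p - 1) = r by rewrite -powRrM mulVf ?powRr1//; lra.
have Aa : A < a.
  rewrite ltNge; apply/negP => aA.
  have : a `^ (p - 1) <= A `^ (p - 1) by apply: ge0_ler_powR; rewrite ?nnegrE//; lra.
  by rewrite ar /r; lra.
have Fa : 0 <= F * (a - A) by apply: mulr_ge0; lra.
have apA : A `^ p <= a `^ p by apply: ge0_ler_powR; rewrite ?nnegrE//; lra.
have := H a (ltW Aa) => /(@ge0_ler_powR R p (ltW p0) _ _); rewrite !nnegrE powR_ge0.
rewrite -powRrM mulVf ?powRr1; [|lra..] => /(_ _ erefl) le1.
have {}le1 : (1 + F * (a - A)) `^ p <= a `^ p - A `^ p + 1 by apply: le1; lra.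
have c0 : 0 <= 1 + F * (a - A) by lra.
have := powR_tangent_le R p (1 + F * (a - A)) 1 p1 c0 ler01.
rewrite !powR1 mulr1 => le2.
have := powR_tangent_le R p A a p1 A0 a0.
rewrite ar => le3.
have : 0 < p * (F - r) * (a - A) by rewrite !mulr_gt0// /r; lra.
nra.
Qed.

(** The functional is tested on [(s a, x2)] with [a >= |x1|], so the first coordinate only moves
    outwards. The sign [s] is a parameter because at [x1 = 0] both signs are used. *)
Lemma supporting_coord_le (R : realType) (p F1 F2 x1 x2 s : R) : 1 < p ->
  (forall y1 y2, F1 * y1 + F2 * y2 <= (`|y1| `^ p + `|y2| `^ p) `^ p^-1) ->
  `|x1| `^ p + `|x2| `^ p = 1 -> F1 * x1 + F2 * x2 = 1 ->
  s ^+ 2 = 1 -> x1 = s * `|x1| -> s * F1 <= `|x1| `^ (p - 1).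
Proof.
move=> p1 HF x1E FxE s2 xs; apply: supporting_slope_le => // a xa.
have s1 : `|s| = 1 by apply/eqP; rewrite -sqr_norm_eq1 s2.
have := HF (s * a) x2.
rewrite normrM s1 mul1r ger0_norm ?(le_trans _ xa)//.
have -> : `|x2| `^ p = 1 - `|x1| `^ p by rewrite -x1E; ring.
have -> : a `^ p + (1 - `|x1| `^ p) = a `^ p - `|x1| `^ p + 1 by ring.
apply: le_trans; rewrite le_eqVlt; apply/orP; left; apply/eqP.
have -> : F2 * x2 = 1 - F1 * x1 by rewrite -FxE; ring.
by rewrite {2}xs; ring.
Qed.

Lemma supporting_coordM_le (R : realType) (p F1 F2 x1 x2 : R) : 1 < p ->
  (forall y1 y2, F1 * y1 + F2 * y2 <= (`|y1| `^ p + `|y2| `^ p) `^ p^-1) ->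
  `|x1| `^ p + `|x2| `^ p = 1 -> F1 * x1 + F2 * x2 = 1 ->
  F1 * x1 <= `|x1| `^ p.
Proof.
move=> p1 HF xE FE; rewrite -powR_pred_mul//; last lra.
pose s : R := (-1) ^+ (x1 < 0)%R.
have xs : x1 = s * `|x1| by rewrite /s -numEsign.
rewrite {1}xs mulrA (mulrC F1); apply: ler_wpM2r => //.
by apply: (supporting_coord_le R p F1 F2 x1 x2 s) => //; rewrite /s sqrr_sign.
Qed.

(** The products [F1 x1] and [F2 x2] are at most [|x1|^p] and [|x2|^p]; both pairs sum to 1, so
    equality holds in each. At [x1 = 0] the slope bound for both signs forces [F1 = 0]. *)
Lemma supporting_coord (R : realType) (p F1 F2 x1 x2 : R) : 1 < p ->
  (forall y1 y2, F1 * y1 + F2 * y2 <= (`|y1| `^ p + `|y2| `^ p) `^ p^-1) ->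
  `|x1| `^ p + `|x2| `^ p = 1 -> F1 * x1 + F2 * x2 = 1 ->
  F1 = Num.sg x1 * `|x1| `^ (p - 1).
Proof.
move=> p1 HF xE FE.
have [x0|x0] := eqVneq x1 0.
  have H s : s ^+ 2 = 1 -> s * F1 <= 0.
    move=> s2; have := supporting_coord_le R p F1 F2 x1 x2 s p1 HF xE FE s2.
    rewrite x0 normr0 mulr0 powR0; last lra.
    by apply.
  have := H 1 (expr1n _ _); have := H (-1) (sqrr_sign _ 1); rewrite x0 sgr0 mul0r.
  lra.
have HF' y2 y1 : F2 * y2 + F1 * y1 <= (`|y2| `^ p + `|y1| `^ p) `^ p^-1.
  by rewrite addrC [leRHS in _ <= leRHS]/= (addrC (_ `^ _)).
have h1 := supporting_coordM_le R p F1 F2 x1 x2 p1 HF xE FE.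
have h2 : F2 * x2 <= `|x2| `^ p.
  by apply: (supporting_coordM_le R p F2 F1 x2 x1); rewrite // addrC.
apply: (mulIf x0); have -> : F1 * x1 = `|x1| `^ p by lra.
by rewrite {4}[x1]numEsg mulrACA -expr2 sqr_sg x0 mul1r powR_pred_mul//; lra.
Qed.

(** By symmetry [B <= A]. With [t = B / A] the expression is [A^p |t - t^(p-1)|], and the
    normalisation gives [A^p = 1 / (1 + t^p)]. *)
Lemma pair_le_Mp (R : realType) (p A B : R) : 1 < p -> 0 <= A -> 0 <= B ->
  A `^ p + B `^ p = 1 -> `|A `^ (p - 1) * B - B `^ (p - 1) * A| <= Mp p.
Proof.
wlog BA : A B / B <= A.
  move=> H p1 A0 B0 AB; have [BA|/ltW BA] := leP B A; first exact: H.
  by rewrite distrC; apply: H; rewrite // addrC.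
move=> p1 A0 B0 AB; have p0 : 0 < p by lra.
have {}A0 : 0 < A.
  rewrite lt_neqAle A0 andbT eq_sym; apply/eqP => A00; move: AB.
  have -> : B = 0 by apply/eqP; rewrite eq_le B0 -A00 BA.
  by rewrite A00 powR0 ?gt_eqF// => /eqP; rewrite addr0 eq_sym oner_eq0.
pose t := B / A.
have t0 : 0 <= t by rewrite divr_ge0// ltW.
have t1 : t <= 1 by rewrite ler_pdivrMr// mul1r.
have BE : B = A * t by rewrite /t mulrC divfK// gt_eqF.
have [_ ub] := Mp_max p1.
have /ub : [set Mp_quotient p t | t in `[0, 1]] (Mp_quotient p t).
  by exists t => //=; rewrite in_itv /= t0 t1.
apply: le_trans; rewrite /Mp_quotient.
have Ap : A `^ p = (1 + t `^ p)^-1.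
  have D0 : 0 < 1 + t `^ p by rewrite ltr_pwDl// powR_ge0.
  apply: (mulIf (lt0r_neq0 D0)); rewrite mulVf ?gt_eqF//.
  by rewrite mulrDr mulr1 -powRM ?(ltW A0)// -BE.
rewrite -Ap -(ger0_norm (powR_ge0 A p)) -normrM -normrN.
rewrite le_eqVlt; apply/orP; left; apply/eqP; congr `|_|.
rewrite BE powRM ?(ltW A0)// -(powR_pred_mul R p A p0 (ltW A0)); ring.
Qed.

(** * Operator norm and numerical radius in a normed space *)

Lemma operator_norm_le (R : realType) (X Y : normedModType R) (f : X -> Y)
    (K : R) :
  (forall x, `|x| <= 1 -> `|f x| <= K) -> operator_norm f <= K.
Proof.
move=> H; apply: ge_sup; first by exists `|f 0|, 0 => //=; rewrite normr0 ler01.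
by move=> _ [x /= x1 <-]; exact: H.
Qed.

(* A set of reals without supremum has [sup] equal to [0], so
   [operator_norm f = 1] entails boundedness. *)
Lemma operator_norm1_le (R : realType) (X Y : normedModType R) (f : X -> Y) x :
  operator_norm f = 1 -> `|x| <= 1 -> `|f x| <= 1.
Proof.
move=> f1 x1; have [[_ ub]|/sup_out] :=
    pselect (has_sup [set `|f x| | x in [set x : X | `|x| <= 1]]).
  by rewrite -[leRHS]f1; apply: ub_le_sup => //; exists x.
by rewrite -/(operator_norm f) f1 => /eqP; rewrite oner_eq0.
Qed.

Lemma operator_norm1_contracting (R : realType) (X Y : normedModType R)
    (f : {linear X -> Y}) x :
  operator_norm f = 1 -> `|f x| <= `|x|.
Proof.
move=> f1; have [->|x0] := eqVneq x 0; first by rewrite linear0 !normr0.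
have nx : 0 < `|x| by rewrite normr_gt0.
have : `|f (`|x|^-1 *: x)| <= 1.
  apply: operator_norm1_le => //.
  by rewrite normrZ gtr0_norm ?invr_gt0// mulVf ?gt_eqF.
by rewrite linearZ normrZ gtr0_norm ?invr_gt0// ler_pdivrMl// mulr1.
Qed.

Lemma linear_bounded_near (R : realType) (X Y : normedModType R)
    (f : {linear X -> Y}) (K : R) :
  (forall x, `|f x| <= K * `|x|) -> bounded_near f (nbhs 0).
Proof.
move=> H; apply/linear_boundedP; near=> r => x.
apply: (le_trans (H x)); apply: ler_wpM2r; first exact: normr_ge0.
by near: r; apply: nbhs_pinfty_ge; exact: num_real.
Unshelve. all: by end_near. Qed.

Lemma numerical_radius_ge0 (R : realType) (X : normedModType R) (T : X -> X) :
  0 <= numerical_radius T.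
Proof.
rewrite /numerical_radius; set E := [set r | _].
(* If the set is empty or unbounded, [sup] takes its default value 0. *)
have [[[r [f [x Ex]]] ub]|/sup_out ->//] := pselect (has_sup E).
apply: (@le_trans _ _ `|f (T x)|) => //.
by apply: ub_le_sup => //; exists f, x; case: Ex.
Qed.

(** The bound on [T] makes the set of values bounded above by [K], so that [sup] is a genuine
    supremum. *)
Lemma numerical_radius_ge (R : realType) (X : normedModType R) (T : X -> X)
    (K : R) (f : {linear X -> R^o}) (x : X) :
  (forall y, `|T y| <= K * `|y|) ->
  continuous f -> operator_norm f = 1 -> `|x| = 1 -> f x = 1 ->
  `|f (T x)| <= numerical_radius T.
Proof.
move=> HT fc f1 x1 fx1; apply: ub_le_sup; last by exists f, x.
exists K => _ [g [y [_ g1 y1 _ ->]]].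
apply: (le_trans (operator_norm1_contracting _ _ _ _ _ g1)).
by rewrite -[K]mulr1 -y1.
Qed.

(** Dividing [F] by [m] and [x] by its norm gives an admissible pair, so unnormalised pairs can
    serve as tests. *)
Lemma numerical_radius_homogeneous (R : realType) (X : normedModType R)
    (T : {linear X -> X}) (K : R) (F : {linear X -> R^o}) (x : X) (m : R) :
  (forall y, `|T y| <= K * `|y|) -> 0 < m ->
  (forall y, `|F y| <= m * `|y|) -> F x = m * `|x| -> 0 < `|x| ->
  `|F (T x)| <= numerical_radius T * (m * `|x|).
Proof.
move=> HT m0 HF Fx x0.
pose G : {linear X -> R^o} := m^-1 \*: F.
pose z := `|x|^-1 *: x.
have GE y : G y = m^-1 * F y by [].
have Gle y : `|G y| <= `|y|.
  by rewrite GE normrM gtr0_norm ?invr_gt0// ler_pdivrMl.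
have z1 : `|z| = 1 by rewrite normrZ gtr0_norm ?invr_gt0// mulVf ?gt_eqF.
have Gz : G z = 1.
  by rewrite linearZ GE Fx mulKf ?gt_eqF// [LHS]mulVf// gt_eqF.
have Gc : continuous G.
  apply: bounded_linear_continuous; apply: (linear_bounded_near _ _ _ _ 1) => y.
  by rewrite mul1r.
have G1 : operator_norm G = 1.
  apply/eqP; rewrite eq_le; apply/andP; split.
    by apply: operator_norm_le => y; apply: le_trans.
  rewrite -(normr1 R) -Gz; apply: ub_le_sup; last by exists z => //=; rewrite z1.
  by exists 1 => _ [y /= y1 <-]; exact: le_trans (Gle y) y1.
have := numerical_radius_ge R _ T K G z HT Gc G1 z1 Gz.
have -> : G (T z) = (m * `|x|)^-1 * F (T x).
  by rewrite /z !linearZ GE invfM -mulrA; exact: mulrCA.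
rewrite normrM gtr0_norm ?invr_gt0 ?mulr_gt0// ler_pdivrMl ?mulr_gt0//.
by rewrite mulrC.
Qed.

(** * Functionals, operators and test pairs on the plane *)

Definition lp2_form (R : realType) (p : R) (p1 : 1 <= p) (a b : R)
  (x : lp2 p1) : R^o := a * x.1 + b * x.2.

Lemma lp2_form_is_linear (R : realType) (p : R) (p1 : 1 <= p) (a b : R) :
  linear (lp2_form R p p1 a b).
Proof.
move=> k [x1 x2] [y1 y2]; rewrite /lp2_form /= /GRing.scale /=.
ring.
Qed.

HB.instance Definition _ (R : realType) (p : R) (p1 : 1 <= p) (a b : R) :=
  GRing.isLinear.Build R (lp2 p1) R^o _ (lp2_form R p p1 a b)
    (lp2_form_is_linear R p p1 a b).

Definition lp2_rotation (R : realType) (p : R) (p1 : 1 <= p)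
  (x : lp2 p1) : lp2 p1 := (x.2, - x.1).

Lemma lp2_rotation_is_linear (R : realType) (p : R) (p1 : 1 <= p) :
  linear (lp2_rotation R p p1).
Proof.
move=> k [x1 x2] [y1 y2]; apply/pair_equal_spec; split => //=.
by rewrite opprD scalerN.
Qed.

HB.instance Definition _ (R : realType) (p : R) (p1 : 1 <= p) :=
  GRing.isLinear.Build R (lp2 p1) (lp2 p1) _ (lp2_rotation R p p1)
    (lp2_rotation_is_linear R p p1).

(** Up to a scalar, the form is the support functional at [(A, s B)]; the constant is the dual norm
    of its coefficients. *)
Lemma lp2_form_norm_le (R : realType) (p : R) (p1 : 1 <= p) (A B s : R)
    (y : lp2 p1) :
  1 < p -> 0 <= A -> 0 <= B -> `|s| = 1 ->
  `|lp2_form R p p1 (A `^ (p - 1)) (s * B `^ (p - 1)) y| <=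
    (A `^ p + B `^ p) `^ (1 - p^-1) * `|y|.
Proof.
move=> p_gt1 A0 B0 s1.
have := powR_hoelder R p A B `|y.1 : R| `|y.2 : R| p_gt1 A0 B0
  (normr_ge0 _) (normr_ge0 _).
rewrite -lp2_normE; apply: le_trans.
apply: (le_trans (ler_normD _ _)); rewrite !normrM s1 mul1r.
by rewrite !(ger0_norm (powR_ge0 _ _)).
Qed.

(** This is the equality case of Hoelder's inequality: with [N = A^p + B^p], the form takes at
    [(A, s B)] the value [N], the product of its norm bound [N^(1 - 1/p)] and the norm [N^(1/p)] of
    the vector. *)
Lemma numerical_radius_test (R : realType) (p : R) (p1 : 1 <= p)
    (T : {linear lp2 p1 -> lp2 p1}) (K A B s : R) :
  (forall y, `|T y| <= K * `|y|) ->
  1 < p -> 0 <= A -> 0 <= B -> `|s| = 1 -> 0 < A `^ p + B `^ p ->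
  `|lp2_form R p p1 (A `^ (p - 1)) (s * B `^ (p - 1)) (T (A, s * B))| <=
    numerical_radius T * (A `^ p + B `^ p).
Proof.
move=> HT p_gt1 A0 B0 s1 N0; have p0 : 0 < p by lra.
have ss : s * s = 1 by rewrite -expr2 -real_normK ?num_real// s1 expr1n.
set N := A `^ p + B `^ p in N0 *.
pose x : lp2 p1 := (A, s * B).
set F : {linear lp2 p1 -> R^o} := lp2_form R p p1 (A `^ (p - 1)) (s * B `^ (p - 1)).
have n0 : 0 < N `^ p^-1 by rewrite powR_gt0.
have m0 : 0 < N `^ (1 - p^-1) by rewrite powR_gt0.
have nm : N `^ (1 - p^-1) * N `^ p^-1 = N.
  by rewrite -powRD ?subrK ?powRr1 ?(ltW N0)// oner_eq0.
have nx : `|x| = N `^ p^-1.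
  by rewrite lp2_normE /= normrM s1 mul1r !ger0_norm.
have Fx : F x = N.
  rewrite /F /= /lp2_form /= mulrACA ss mul1r.
  by rewrite !powR_pred_mul.
have HF y : `|F y| <= N `^ (1 - p^-1) * `|y| by exact: lp2_form_norm_le.
have Fxx : F x = N `^ (1 - p^-1) * `|x| by rewrite Fx nx nm.
have x0 : 0 < `|x| by rewrite nx.
have := numerical_radius_homogeneous R _ T K F x _ HT m0 HF Fxx x0.
by rewrite nx nm.
Qed.

Lemma lp2_linearE (R : realType) (p : R) (p1 : 1 <= p) (W : lmodType R)
    (T : {linear lp2 p1 -> W}) (x : lp2 p1) :
  T x = (x.1 : R) *: T ((1, 0) : lp2 p1) + (x.2 : R) *: T ((0, 1) : lp2 p1).
Proof.
rewrite -!linearZ -linearD; congr (T _).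
case: x => x1 x2; apply/pair_equal_spec; split => /=; rewrite /GRing.scale /=; ring.
Qed.

Lemma lp2_signed_coords_norm (R : realType) (p : R) (p1 : 1 <= p) (x1 x2 : R) :
  (`|((x1, - x2) : lp2 p1)| = `|((x1, x2) : lp2 p1)|) *
  (`|((x2, x1) : lp2 p1)| = `|((x1, x2) : lp2 p1)|) *
  (`|((x2, - x1) : lp2 p1)| = `|((x1, x2) : lp2 p1)|).
Proof.
split; first split; rewrite !lp2_normE /=.
- by rewrite normrN.
- congr (_ `^ _); exact: addrC.
- rewrite normrN; congr (_ `^ _); exact: addrC.
Qed.

Lemma lp2_matrix_norm_le (R : realType) (p : R) (p1 : 1 <= p)
    (a b c d : R) (x : lp2 p1) :
  `|((a * x.1 + b * x.2, c * x.1 + d * x.2) : lp2 p1)| <=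
    (`|a + d| + `|a - d| + `|b + c| + `|b - c|) / 2 * `|x|.
Proof.
case: x => x1 x2 /=.
have -> : ((a * x1 + b * x2, c * x1 + d * x2) : lp2 p1) =
  ((a + d) / 2) *: ((x1, x2) : lp2 p1) + ((a - d) / 2) *: ((x1, - x2) : lp2 p1) +
  ((b + c) / 2) *: ((x2, x1) : lp2 p1) + ((b - c) / 2) *: ((x2, - x1) : lp2 p1).
  by apply/pair_equal_spec; split => /=; rewrite /GRing.scale /=; field.
have tri (y z : lp2 p1) (k l : R) : `|y| <= k -> `|z| <= l -> `|y + z| <= k + l.
  by move=> yk zl; apply: (le_trans (ler_normD _ _)); exact: lerD.
have half (k : R) (y : lp2 p1) : `|y| = `|((x1, x2) : lp2 p1)| ->
    `|(k / 2) *: y| <= `|k| / 2 * `|((x1, x2) : lp2 p1)|.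
  by move=> <-; rewrite normrZ normrM (ger0_norm (x := 2^-1)).
have := lp2_signed_coords_norm R p p1 x1 x2.
move: half; set n := `|((x1, x2) : lp2 p1)| => half [[n1 n2] n3].
have -> : (`|a + d| + `|a - d| + `|b + c| + `|b - c|) / 2 * n =
  `|a + d| / 2 * n + `|a - d| / 2 * n + `|b + c| / 2 * n + `|b - c| / 2 * n by ring.
exact: (tri _ _ _ _ (tri _ _ _ _ (tri _ _ _ _
  (half _ _ erefl) (half _ _ n1)) (half _ _ n2)) (half _ _ n3)).
Qed.

(** * The constant M_p and the lower bound *)

Lemma Mp_ge0 (R : realType) (p : R) : 1 < p -> 0 <= Mp p.
Proof.
move=> p1; have [[t _ <-] _] := Mp_max p1.
by rewrite divr_ge0// addr_ge0// powR_ge0.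
Qed.

(** The range of [p] enters here: for [0 < t < 1] powers of [t] decrease with the exponent, so
    [t^2 <= t^(p-1)] amounts to [p <= 3] and [t^(2 (p-1)) <= t] to [3/2 <= p]. At [t = 0] and
    [t = 1] the quotient vanishes. *)
Lemma Mp_witness (R : realType) (p : R) : 3 / 2 <= p <= 3 ->
  Mp p = 0 \/ exists t u : R,
    [/\ [/\ 0 < t, 0 < u, t < 1 & u < 1], t ^+ 2 <= u, u ^+ 2 <= t,
     u = t `^ (p - 1) & Mp p = `|t - u| / (1 + t * u)] /\ t `^ p = t * u.
Proof.
move=> /andP[p32 p3]; have p1 : 1 < p by lra.
have [[t]] := Mp_max p1; rewrite /= in_itv /= => /andP[t0 t1] <- _.
have [->|tn0] := eqVneq t 0.
  by left; rewrite /Mp_quotient powR0 ?subrr ?normr0 ?mul0r//; lra.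
have [->|tn1] := eqVneq t 1.
  by left; rewrite /Mp_quotient powR1 subrr normr0 mul0r.
right; have {tn0}t0 : 0 < t by rewrite lt_neqAle eq_sym tn0.
have {tn1}t1 : t < 1 by rewrite lt_neqAle tn1.
have tp : t `^ p = t * t `^ (p - 1) by rewrite mulrC powR_pred_mul//; lra.
have mono (r s : R) : s <= r -> t `^ r <= t `^ s.
  by move=> rs; apply: ger_powR => //; rewrite t0 ltW.
exists t, (t `^ (p - 1)); split=> //; split => //; last first.
- by rewrite /Mp_quotient tp distrC.
- rewrite -[leRHS](powRr1 (ltW t0)) -powR_mulrn ?powR_ge0// -powRrM; apply: mono; lra.
- by rewrite -powR_mulrn ?(ltW t0)//; apply: mono; lra.
- split=> //; first exact: powR_gt0.
  have : t `^ (p - 1) < 1 `^ (p - 1).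
    by apply: gt0_ltr_powR; rewrite ?nnegrE ?ler01 ?(ltW t0)//; lra.
  by rewrite powR1.
Qed.

Lemma lp2_index_lower (R : realType) (p : R) (p1 : 1 <= p)
    (T : {linear lp2 p1 -> lp2 p1}) :
  3 / 2 <= p <= 3 -> operator_norm T = 1 -> Mp p <= numerical_radius T.
Proof.
move=> pitv T1; have p_gt1 : 1 < p by case/andP: pitv; lra.
have [->|[t [u [[[t0 u0 t1 u1] tu ut uE ->] tp]]]] := Mp_witness R p pitv.
  exact: numerical_radius_ge0.
pose a : R := (T (1, 0)).1; pose c : R := (T (1, 0)).2.
pose b : R := (T (0, 1)).1; pose d : R := (T (0, 1)).2.
have TE (x : lp2 p1) : T x = (a * x.1 + b * x.2, c * x.1 + d * x.2).
  rewrite lp2_linearE; apply/pair_equal_spec.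
  by rewrite (mulrC a) (mulrC b) (mulrC c) (mulrC d).
pose K := (`|a + d| + `|a - d| + `|b + c| + `|b - c|) / 2.
have TK x : `|T x| <= K * `|x| by rewrite TE; exact: lp2_matrix_norm_le.
have K0 : 0 <= K by rewrite divr_ge0// !addr_ge0.
(* [K] bounds the norm of [T], which is 1. This finally gives [Mp p <= K * Mp p <= V]. *)
have K1 : 1 <= K.
  rewrite -T1; apply: operator_norm_le => x x1; apply: (le_trans (TK x)).
  by rewrite -[leRHS]mulr1; apply: ler_wpM2l.
set V := numerical_radius T.
have pos : 0 < 1 + t * u by rewrite addr_gt0 ?mulr_gt0.
(* The test vectors are [(1, s t)] here and [(t, s)] below; since [t^p = t u], the normalising
   factor is [1 + t u] for both. *)
have test1 s : `|s| = 1 ->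
    `|(a + b * (s * t)) + s * u * (c + d * (s * t))| <= V * (1 + t * u).
  move=> s1; have := numerical_radius_test R p p1 T K 1 t s TK p_gt1 ler01 (ltW t0) s1.
  rewrite !powR1 tp -uE TE /lp2_form /= !mulr1 mul1r; exact.
have test2 s : `|s| = 1 ->
    `|u * (a * t + b * s) + s * (c * t + d * s)| <= V * (1 + t * u).
  move=> s1; have := numerical_radius_test R p p1 T K t 1 s TK p_gt1 (ltW t0) ler01 s1.
  rewrite !powR1 tp -uE TE /lp2_form /= !mulr1 (addrC _ 1); exact.
(* The signs [s = 1] and [s = -1] bound [|x + y|] and [|x - y|], whose maximum is [|x| + |y|]. *)
have norm_sum (x y W : R) : `|x + y| <= W -> `|x - y| <= W -> `|x| + `|y| <= W.
  rewrite !ler_norml => /andP[? ?] /andP[? ?].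
  by case: (ger0P x); case: (ger0P y); lra.
have h1 : `|a + d * (t * u)| + `|b * t + c * u| <= V * (1 + t * u).
  apply: norm_sum.
    have := test1 1 (normr1 R); congr (`|_| <= _); ring.
  have := test1 (- 1) (normrN1 R); congr (`|_| <= _); ring.
have h2 : `|a * (t * u) + d| + `|b * u + c * t| <= V * (1 + t * u).
  apply: norm_sum.
    have := test2 1 (normr1 R); congr (`|_| <= _); ring.
  have := test2 (- 1) (normrN1 R); congr (`|_| <= _); ring.
have := isometry_coef_bound R t u a b c d V t0 u0 t1 u1 tu ut h1 h2.
rewrite -/K; apply: le_trans.
by rewrite -[leLHS]mul1r; apply: ler_wpM2r => //; rewrite divr_ge0// ltW.
Qed.

(** * The rotation and the upper bound *)

Lemma lp2_rotation_norm (R : realType) (p : R) (p1 : 1 <= p) (x : lp2 p1) :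
  `|lp2_rotation R p p1 x| = `|x|.
Proof. case: x => x1 x2; exact: (lp2_signed_coords_norm R p p1 x1 x2).2. Qed.

Lemma lp2_rotation_operator_norm (R : realType) (p : R) (p1 : 1 <= p) :
  operator_norm (lp2_rotation R p p1) = 1.
Proof.
have p0 : p != 0 by rewrite gt_eqF//; lra.
apply/eqP; rewrite eq_le; apply/andP; split.
  by apply: operator_norm_le => x; rewrite lp2_rotation_norm.
have e1 : `|((1, 0) : lp2 p1)| = 1.
  by rewrite lp2_normE /= normr1 normr0 powR1 powR0// addr0 powR1.
apply: ub_le_sup; first by exists 1 => _ [x /= x1 <-]; rewrite lp2_rotation_norm.
exists ((1, 0) : lp2 p1); first by rewrite /= e1.
by rewrite lp2_rotation_norm.
Qed.

(** By [supporting_coord] the functional is determined by [x], and its value at the rotated vector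
    is, up to a factor in [{-1, 0, 1}], the expression bounded in [pair_le_Mp]. *)
Lemma lp2_support_rotation (R : realType) (p : R) (p1 : 1 <= p)
    (f : {linear lp2 p1 -> R^o}) (x : lp2 p1) :
  1 < p -> operator_norm f = 1 -> `|x| = 1 -> f x = 1 ->
  `|f (lp2_rotation R p p1 x)| <= Mp p.
Proof.
move=> p_gt1 f1 x1 fx1.
have p0 : 0 < p by lra.
pose F1 : R := f ((1, 0) : lp2 p1); pose F2 : R := f ((0, 1) : lp2 p1).
have fE (y : lp2 p1) : f y = F1 * y.1 + F2 * y.2.
  by rewrite lp2_linearE (mulrC F1) (mulrC F2).
case: x x1 fx1 => x1 x2 xn fx.
have {}xn : `|x1 : R| `^ p + `|x2 : R| `^ p = 1.
  have S0 : 0 <= `|x1 : R| `^ p + `|x2 : R| `^ p by rewrite addr_ge0 ?powR_ge0.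
  have := congr1 (fun r => r `^ p) xn.
  by rewrite /= lp2_normE /= powR1 -powRrM mulVf ?gt_eqF// powRr1.
have {}fx : F1 * x1 + F2 * x2 = 1 by rewrite -fx fE.
have HF y1 y2 : F1 * y1 + F2 * y2 <= (`|y1| `^ p + `|y2| `^ p) `^ p^-1.
  have := operator_norm1_contracting R _ _ f (y1, y2) f1.
  rewrite fE lp2_normE /=; apply: le_trans; exact: ler_norm.
have HF' y2 y1 : F2 * y2 + F1 * y1 <= (`|y2| `^ p + `|y1| `^ p) `^ p^-1.
  by rewrite addrC (addrC (_ `^ p)); exact: HF.
have F1E := supporting_coord R p F1 F2 x1 x2 p_gt1 HF xn fx.
have F2E : F2 = Num.sg x2 * `|x2| `^ (p - 1).
  by apply: (supporting_coord R p F2 F1 x2 x1) => //; rewrite addrC.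
rewrite fE /=.
have -> : F1 * x2 + F2 * - x1 = Num.sg x1 * Num.sg x2 *
    (`|x1| `^ (p - 1) * `|x2| - `|x2| `^ (p - 1) * `|x1|).
  rewrite F1E F2E [X in _ * X + _]numEsg [X in _ + _ * - X]numEsg; ring.
have := pair_le_Mp R p `|x1| `|x2| p_gt1 (normr_ge0 _) (normr_ge0 _) xn.
apply: le_trans; rewrite normrM -[leRHS]mul1r; apply: ler_wpM2r => //.
by rewrite normrM !normr_sg -natrM; case: (x1 != 0); case: (x2 != 0); rewrite ?lexx ?ler01.
Qed.

Theorem theorem3 (R : realType) (p : R) (hp : p \in `[3 / 2, 3]) :
  numerical_index (lp2 (ge1_itv hp)) = Mp p /\
  Mp p = sup [set `|t `^ (p - 1) - t| / (1 + t `^ p) | t in `[0, 1]].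
Proof.
have pitv : 3 / 2 <= p <= 3 by move: hp; rewrite in_itv.
have p1 : 1 < p by case/andP: pitv; lra.
split; last first.
  have [Mp_in Mp_ub] := Mp_max p1.
  apply/eqP; rewrite eq_le; apply/andP; split.
    by apply: ub_le_sup; first exists (Mp p).
  by apply: ge_sup; first exists (Mp p).
set rot : {linear lp2 (ge1_itv hp) -> lp2 (ge1_itv hp)} :=
  lp2_rotation R p (ge1_itv hp).
(* The rotation provides the upper bound on [inf], and also the nonemptiness that lets a lower bound
   pass to [inf]. *)
have rotI : [set r : R | exists T : {linear lp2 (ge1_itv hp) -> lp2 (ge1_itv hp)},
    [/\ bounded_near T (nbhs 0), operator_norm T = 1 & r = numerical_radius T]]
    (numerical_radius rot).
  exists rot; split => //; last exact: lp2_rotation_operator_norm.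
  apply: (linear_bounded_near _ _ _ _ 1) => x.
  by rewrite mul1r lp2_rotation_norm.
apply/eqP; rewrite eq_le; apply/andP; split; last first.
  apply: lb_le_inf; first by exists (numerical_radius rot).
  by move=> _ [T [_ T1 ->]]; exact: lp2_index_lower.
apply: (@le_trans _ _ (numerical_radius rot)).
  (* For [inf] to lie below its members the set must be bounded below, here by 0. *)
  apply: ge_inf rotI; exists 0 => _ [T [_ _ ->]]; exact: numerical_radius_ge0.
rewrite /numerical_radius; set E := [set r | _].
(* Without a supremum, [sup] is 0 and the nonnegativity of [Mp p] concludes. *)
have [[nE _]|/sup_out ->] := pselect (has_sup E); last exact: Mp_ge0.
apply: ge_sup => // _ [f [x [_ f1 x1 fx ->]]].
exact: lp2_support_rotation.
Qed.
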